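(* Let $G$ be a Hausdorff topological group and $f: G \to \mathbb{R}$ a function. The following conditions are equivalent: (1) $f \in UC(G)$. (2) The function $f$ is a (bicontinuous) matrix coefficient for some continuous co-birepresentation $h_1: G \to \mathrm{Iso}(V)$, $h_2: G \to \mathrm{Iso}(W)$ in a regular bilinear mapping $\omega: V \times W \to \mathbb{R}$ with Banach spaces $V$ and $W$; that is, there are $v \in V$ and $\psi \in W$ with $f = m_{v,\psi}$. Moreover, in (2) one can always assume without restriction of generality that $d(V) \leq d(G)$ and $d(W) \leq d(G)$.
   Context: $UC(G)$ is the set of bounded functions $f: G \to \mathbb{R}$ that are both right and left uniformly continuous: for every $\varepsilon > 0$ there is a neighborhood $U$ of the identity with $\sup_{g \in G} |f(ug) - f(g)| < \varepsilon$ and $\sup_{g \in G} |f(gu) - f(g)| < \varepsilon$ for all $u \in U$. For a normed space $V$, $\mathrm{Iso}(V)$ is the topological group of all linear onto isometries of $V$ with the strong operator topology (pointwise convergence on $V$). A co-homomorphism is a map $h$ of groups with $h(g_1 g_2) = h(g_2) h(g_1)$. A continuous co-birepresentation of $G$ in a continuous bilinear map $\omega: V \times W \to \mathbb{R}$ is a pair consisting of a continuous co-homomorphism $h_1: G \to \mathrm{Iso}(V)$ (giving a right action $vg = h_1(g)(v)$) and a continuous homomorphism $h_2: G \to \mathrm{Iso}(W)$ (giving a left action $g\psi = h_2(g)(\psi)$) such that $\omega(vg, \psi) = \omega(v, g\psi)$ for all $g \in G$, $v \in V$, $\psi \in W$. For $v \in V$, $\psi \in W$ the matrix coefficient is $m_{v,\psi}: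 G \to \mathbb{R}$, $m_{v,\psi}(g) = \omega(vg,\psi)$; it is bicontinuous if the orbit maps $G \to V$, $g \mapsto vg$ and $G \to W$, $g \mapsto g\psi$ are norm continuous (automatic for continuous co-birepresentations). A bilinear mapping $\omega: V \times W \to \mathbb{R}$ is regular if $|\omega(v,\psi)| \leq \|v\|\,\|\psi\|$ for all $(v,\psi) \in V \times W$. $d$ denotes density (least cardinality of a dense subset), taken to be infinite (replaced by $\aleph_0$ if finite). *)

(* Defs.v *)
From HB Require Import structures.
From mathcomp Require Import all_boot all_order all_algebra.
From mathcomp Require Import all_classical all_reals all_analysis.

Set Implicit Arguments.
Unset Strict Implicit.
Unset Printing Implicit Defensive.

Import Order.TTheory GRing.Theory Num.Theory.
Import numFieldNormedType.Exports.

Local Open Scope classical_set_scope.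
Local Open Scope ring_scope.

HB.mixin Record isTopologicalGroup G of Group G & Topological G := {
  mulg_continuous : continuous (fun p : G * G => (p.1 * p.2)%g) ;
  invg_continuous : continuous (fun x : G => (x^-1)%g)
}.

#[short(type="topGroupType")]
HB.structure Definition TopGroup :=
  {G of Group G & Topological G & isTopologicalGroup G}.

Section UniformlyContinuous.
Variables (R : realType) (G : topGroupType).

(* The suprema are taken in the extended reals, so that they are meaningful
   without a boundedness side condition. *)
Definition UC (f : G -> R) : Prop :=
  bounded_fun f /\
  forall e : R, 0 < e ->
    exists2 U : set G, nbhs (1%g : G) U &
      forall u, U u ->
        (ereal_sup [set `|f (u * g)%g - f g|%:E | g in [set: G]] < e%:E)%E /\
        (ereal_sup [set `|f (g * u)%g - f g|%:E | g in [set: G]] < e%:E)%E.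

End UniformlyContinuous.

Section Iso.
Variables (R : realType) (V : normedModType R).

Record iso := Iso {
  iso_fun :> {linear V -> V} ;
  iso_isometry : forall v, `|iso_fun v| = `|v| ;
  iso_onto : forall w, exists v, iso_fun v = w
}.

Lemma isoP (S T : iso) : (forall v, S v = T v) -> S = T.
Proof.
case: S T => [f fi fo] [g gi go] /= /funext fg.
have {}fg : f = g.
  case: f g fg {fi fo gi go} => [f [[fa] [fb]]] [g [[ga] [gb]]] /= e.
  case: _ / e in ga gb *.
  by rewrite (Prop_irrelevance fa ga) (Prop_irrelevance fb gb).
case: _ / fg in gi go *.
by rewrite (Prop_irrelevance fi gi) (Prop_irrelevance fo go).
Qed.

HB.instance Definition _ := gen_eqMixin iso.
HB.instance Definition _ := gen_choiceMixin iso.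

Definition iso_one : iso :=
  @Iso idfun (fun=> erefl) (fun w => ex_intro _ w erefl).

Lemma iso_mul_isometry (S T : iso) v : `|(S \o T) v| = `|v|.
Proof. by rewrite /= !iso_isometry. Qed.

Lemma iso_mul_onto (S T : iso) w : exists v, (S \o T) v = w.
Proof.
by have [u <-] := iso_onto S w; have [v <-] := iso_onto T u; exists v.
Qed.

Definition iso_mul (S T : iso) : iso :=
  Iso (iso_mul_isometry S T) (iso_mul_onto S T).

Definition iso_inv_fun (T : iso) (w : V) : V := sval (cid (iso_onto T w)).

Lemma iso_inv_funK (T : iso) : cancel (iso_inv_fun T) T.
Proof. by move=> w; rewrite /iso_inv_fun; case: cid. Qed.

Lemma iso_inj (T : iso) : injective T.
Proof.
move=> u v Tuv; apply/eqP; rewrite -subr_eq0 -normr_eq0 -(iso_isometry T).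
by rewrite linearB Tuv subrr normr0.
Qed.

Lemma iso_funK (T : iso) : cancel T (iso_inv_fun T).
Proof. by move=> v; apply: (@iso_inj T); rewrite iso_inv_funK. Qed.

Lemma iso_inv_fun_linear (T : iso) : linear (iso_inv_fun T).
Proof.
by move=> a u v; apply: (@iso_inj T); rewrite linearP !iso_inv_funK.
Qed.

HB.instance Definition _ (T : iso) :=
  GRing.isLinear.Build R V V *:%R (iso_inv_fun T) (iso_inv_fun_linear T).

Lemma iso_inv_isometry (T : iso) w : `|iso_inv_fun T w| = `|w|.
Proof. by rewrite -(iso_isometry T) iso_inv_funK. Qed.

Lemma iso_inv_onto (T : iso) v : exists w, iso_inv_fun T w = v.
Proof. by exists (T v); rewrite iso_funK. Qed.

Definition iso_inv (T : iso) : iso :=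
  Iso (iso_inv_isometry T) (iso_inv_onto T).

Lemma iso_mulA : associative iso_mul.
Proof. by move=> S T U; apply: isoP. Qed.

Lemma iso_mul1g : left_id iso_one iso_mul.
Proof. by move=> T; apply: isoP. Qed.

Lemma iso_mulg1 : right_id iso_one iso_mul.
Proof. by move=> T; apply: isoP. Qed.

Lemma iso_mulVg : left_inverse iso_one iso_inv iso_mul.
Proof. by move=> T; apply: isoP => v /=; exact: iso_funK. Qed.

Lemma iso_mulgV : right_inverse iso_one iso_inv iso_mul.
Proof. by move=> T; apply: isoP => v /=; exact: iso_inv_funK. Qed.

HB.instance Definition _ := isGroup.Build iso
  iso_mulA iso_mul1g iso_mulg1 iso_mulVg iso_mulgV.

(* Strong operator topology: the initial topology of the inclusion into the
   maps V -> V with the topology of pointwise (norm) convergence. *)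
Definition iso_ptws (T : iso) : {ptws V -> V} := T.

HB.instance Definition _ := Topological.copy iso (initial_topology iso_ptws).

Lemma iso_cvgP (F : set_system iso) (T : iso) : Filter F ->
  (F --> T) <-> forall v, (fun S : iso => S v) @ F --> T v.
Proof.
move=> FF; split=> [FT v|FT].
- have cT : {for T, continuous (iso_ptws : iso -> _)}.
    exact: (@initial_continuous iso {ptws V -> V} iso_ptws T).
  have : iso_ptws @ F --> iso_ptws T by apply: cvg_trans cT; exact: cvg_app.
  by move=> /pointwise_cvgP/(_ v).
- have {}FT : iso_ptws @ F --> iso_ptws T by apply/pointwise_cvgP => v; exact: FT.
  move=> A [_ [[B Bo <-] BT BA]]; apply: filterS BA _.
  by apply: FT; exact: open_nbhs_nbhs.
Qed.

Lemma iso_cvg (T : iso) v : (fun S : iso => S v) @ T --> T v.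
Proof. exact: ((@iso_cvgP (nbhs T) T _).1 cvg_id). Qed.

Lemma iso_mul_continuous : continuous (fun p : iso * iso => (p.1 * p.2)%g).
Proof.
move=> [S T]; apply/iso_cvgP => v; apply/cvgrPdist_lt => e e0.
rewrite near_map; near=> p.
rewrite /= -[S (T v)](subrK (p.1 (T v))) -addrA.
rewrite (le_lt_trans (ler_normD _ _))// [ltRHS]splitr ltrD//.
- near: p.
  suff : (fun p : iso * iso => p.1 (T v)) @ (S, T) --> S (T v).
    by move=> /cvgrPdist_lt; apply; rewrite divr_gt0.
  by apply: (cvg_comp _ _ cvg_fst (@iso_cvg S (T v))).
- rewrite -linearB iso_isometry; near: p.
  suff : (fun p : iso * iso => p.2 v) @ (S, T) --> T v.
    by move=> /cvgrPdist_lt; apply; rewrite divr_gt0.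
  by apply: (cvg_comp _ _ cvg_snd (@iso_cvg T v)).
Unshelve. all: by end_near. Qed.

Lemma iso_inv_continuous : continuous (fun T : iso => (T^-1)%g).
Proof.
move=> T; have FT := nbhs_filter (T : iso).
apply/iso_cvgP => v; apply/cvgrPdist_lt => e e0.
rewrite near_map; near=> S.
rewrite /= -(iso_isometry S) linearB iso_inv_funK.
rewrite -[X in _ - X](iso_inv_funK T) distrC; near: S.
by have /cvgrPdist_lt := @iso_cvg T (iso_inv_fun T v); apply.
Unshelve. all: by end_near. Qed.

HB.instance Definition _ :=
  isTopologicalGroup.Build iso iso_mul_continuous iso_inv_continuous.

End Iso.

Section Cobirepresentation.
Variables (R : realType) (G : topGroupType) (V W : normedModType R).
Implicit Types (omega : {bilinear V -> W -> R | *%R & *%R}).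

Definition regular_bilinear omega : Prop :=
  forall v psi, `|omega v psi| <= `|v| * `|psi|.

Definition continuous_cobirep omega (h1 : G -> iso V) (h2 : G -> iso W) :
  Prop :=
  continuous (fun p : V * W => omega p.1 p.2) /\
  [/\ continuous h1, {morph h1 : x y / (x * y)%g >-> (y * x)%g},
      continuous h2, {morph h2 : x y / (x * y)%g >-> (x * y)%g} &
      forall g v psi, omega (h1 g v) psi = omega v (h2 g psi)].

Definition matrix_coef omega (h1 : G -> iso V) (v : V) (psi : W) : G -> R :=
  fun g => omega (h1 g v) psi.

Definition bicontinuous_coef (h1 : G -> iso V) (h2 : G -> iso W)
  (v : V) (psi : W) : Prop :=
  continuous (fun g => h1 g v) /\ continuous (fun g => h2 g psi).

Definition is_regular_coef (f : G -> R) : Prop :=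
  exists (omega : {bilinear V -> W -> R | *%R & *%R})
         (h1 : G -> iso V) (h2 : G -> iso W) (v : V) (psi : W),
    [/\ regular_bilinear omega, continuous_cobirep omega h1 h2,
        bicontinuous_coef h1 h2 v psi & f = matrix_coef omega h1 v psi].

End Cobirepresentation.

(* A cardinal is represented by a type, up to bijection: [has_density X K]
   says that K has the least cardinality of a dense subset of X, or aleph_0
   when that least cardinality is finite. *)
Definition has_density (X : topologicalType) (K : Type) : Prop :=
  exists D : set X,
    [/\ dense D, (forall E : set X, dense E -> (D #<= E)%card) &
        if `[< finite_set D >] then ([set: K] #= [set: nat])%card
        else ([set: K] #= D)%card].

Definition density_le (X Y : topologicalType) : Prop :=
  exists K L : Type,
    [/\ has_density X K, has_density Y L & ([set: K] #<= [set: L])%card].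

(* Main.v *)
Require Import Defs.
From HB Require Import structures.
From mathcomp Require Import all_boot all_order all_algebra.
From mathcomp Require Import all_classical all_reals all_analysis.

Set Implicit Arguments.
Unset Strict Implicit.
Unset Printing Implicit Defensive.

Import Order.TTheory GRing.Theory Num.Theory.
Import numFieldNormedType.Exports.

Local Open Scope classical_set_scope.
Local Open Scope ring_scope.

(* Only the construction of V and W from f in UC(G) is not routine. Let
   phi(u) = sup_g |f(gu) - f(g)|, which tends to 0 at the identity, and
   rho = sqrt(2 phi). The space V is the closed span of the left translates of
   f for the norm max(sup_g |v(g)|, sup_{g,u} |v(gu) - v(g)| / rho(u)), and W is
   the closed span of the point evaluations in the dual of V. By definition of
   the norm of V, |v(gu) - v(g)| <= rho(u) |v|, hence the orbits of the point
   evaluations are continuous. For f_w(x) = f(wx) the second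
   differences (f_w - f)(gu) - (f_w - f)(g) are bounded both by 2 phi(u) and by
   2 sup_x |f(wx) - f(x)|, hence by the geometric mean of these; dividing by
   rho(u) leaves a bound independent of u which tends to 0 as w tends to the
   identity: the orbit of f in V is continuous as well. Both orbits are
   continuous images of G spanning dense subspaces, so their rational
   combinations over a dense subset of G bound the densities. *)

(** * Comparison of cardinals *)

Lemma card_le_inj (T U : Type) (A : set T) (B : set U) (f : T -> U) :
  (forall x, A x -> B (f x)) ->
  (forall x y, A x -> A y -> f x = f y -> x = y) -> (A #<= B)%card.
Proof.
move=> fAB finj.
have /injfunPex[g] : exists2 g : T -> U, set_fun A B g & set_inj A g.
  by exists f => // x y; rewrite !inE; exact: finj.
exact: inj_card_le.
Qed.

Lemma card_le_ex_inj (T U : Type) (A : set T) : ([set: nat] #<= [set: U])%card ->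
  (A #<= [set: U])%card ->
  exists f : T -> U, forall x y, A x -> A y -> f x = f y -> x = y.
Proof.
move=> /card_leP[g] /card_leP[f].
(* A default value outside [A]; [U] is inhabited because it contains a copy of [nat]. *)
pose u := set_val (g (to_setT 0%N)).
exists (fun x =>
  if pselect (A x) is left Ax then set_val (f (SigSub (mem_set Ax))) else u).
move=> x y Ax Ay; case: pselect => // Ax'; case: pselect => // Ay'.
by move=> /val_inj/inj; rewrite !in_setT => /(_ isT isT)[].
Qed.

(* In the product of the members of the family, a maximal set on which all the
   coordinate projections are injective is mapped onto some member: otherwise a
   point avoiding all its projections could be added to it. *)
Lemma exists_least_card (T : Type) (P : set (set T)) : P !=set0 ->
  exists2 E, P E & forall E', P E' -> (E #<= E')%card.
Proof.
move=> [E0 PE0].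
pose Q (S : set (set T -> T)) :=
  (forall s E, S s -> P E -> E (s E)) /\
  (forall s s' E, S s -> S s' -> P E -> s E = s' E -> s = s').
have [F FQ Ftot|S [[Ssec Sinj] Smax]] := @Zorn_bigcup _ Q.
  split=> [s E [X FX Xs] PE|s s' E [X FX Xs] [Y FY Ys'] PE].
    by have [+ _] := FQ _ FX => /(_ s E); exact.
  have [XY|YX] := Ftot _ _ FX FY.
    by have [_] := FQ _ FY; move=> /(_ s s' E); apply=> //; exact: XY.
  by have [_] := FQ _ FX; move=> /(_ s s' E); apply=> //; exact: YX.
suff [E PE Esur] : exists2 E, P E & forall x, E x -> exists2 s, S s & s E = x.
  exists E => // E' PE'.
  (* [h x] is the element of [S] through [x] at [E]; its value at [E'] embeds [E] in [E']. *)
  have /choice[h hE] x : exists s, E x -> S s /\ s E = x.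
    have [Ex|nEx] := pselect (E x); last by exists (fun=> x).
    by have [s Ss sE] := Esur _ Ex; exists s.
  apply: (@card_le_inj _ _ _ _ (fun x => h x E')) => [x /hE[Sh _]|x y].
    exact: (Ssec _ E' Sh).
  move=> /hE[Shx hx] /hE[Shy hy] hxy.
  by rewrite -hx -hy (Sinj _ _ _ Shx Shy PE' hxy).
apply: contrapT => noE.
have /choice[t tE] E : exists x, P E -> E x /\ forall s, S s -> s E <> x.
  have [PE|nPE] := pselect (P E).
    apply: contrapT => nx; apply: noE; exists E => // x Ex.
    apply: contrapT => ns; apply: nx; exists x => _; split=> // s Ss sE.
    by apply: ns; exists s.
  have [[x _]|T0] := pselect (exists x : T, True); first by exists x.
  exfalso; apply: noE; exists E0 => // x _; exfalso; apply: T0.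
  by exists x.
apply: (Smax (S `|` [set t])).
  split=> [s|/(_ t (or_intror erefl)) St]; first by left.
  by have [_ /(_ _ St)] := tE _ PE0; apply.
split=> [s E [Ss|->] PE|s s' E [Ss|->] [Ss'|->] PE //].
- exact: (Ssec _ E Ss).
- exact: (tE _ PE).1.
- by move=> sE; exact: Sinj sE.
- by move=> sE; case: ((tE _ PE).2 _ Ss sE).
- by move=> sE; case: ((tE _ PE).2 _ Ss'); rewrite sE.
Qed.

(** A least member of the pair [A], [B] embeds in the other one. *)
Lemma card_le_total (T : Type) (A B : set T) : (A #<= B)%card \/ (B #<= A)%card.
Proof.
have [|E [->|->] Emin] := @exists_least_card T [set X | X = A \/ X = B].
- by exists A; left.
- by left; apply: Emin; right.
- by right; apply: Emin; left.
Qed.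

(** * Finite sequences over an infinite type *)

Section SequencesOfInfiniteType.
Variables (L : choiceType) (j : nat -> L).
Hypothesis j_inj : injective j.

(* Partial injections are represented by their graphs; [support F] is the set
   A on which the graph F is meant to be an injection of [seq A] into A. *)
Let support (F : set (seq L * L)) : set L :=
  range j `|` [set x | exists s y, F (s, y) /\ x \in s].

Let seq_injection (F : set (seq L * L)) := F = set0 \/
  [/\ forall s x y, F (s, x) -> F (s, y) -> x = y,
      forall s s' x, F (s, x) -> F (s', x) -> s = s',
      forall s x, F (s, x) -> support F x &
      forall s : seq L, (forall z, z \in s -> support F z) -> exists x, F (s, x)].

Let supportS F F' : F `<=` F' -> support F `<=` support F'.
Proof.
move=> FF' x [jx|[s [y [Fsy xs]]]]; [by left|right].
by exists s, y; split=> //; exact: FF'.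
Qed.

Let seq_injection_bigcup (C : set (set (seq L * L))) :
  C `<=` seq_injection -> total_on C subset ->
  seq_injection (\bigcup_(X in C) X).
Proof.
move=> CP Ctot; have [[X0 [CX0 [p0 X0p0]]]|C0] :=
    pselect (exists X, C X /\ exists p, X p); last first.
  by left; apply/seteqP; split=> // p [X CX Xp]; case: C0; exists X; split=> //; exists p.
have CPn X p : C X -> X p -> [/\ forall s x y, X (s, x) -> X (s, y) -> x = y,
      forall s s' x, X (s, x) -> X (s', x) -> s = s',
      forall s x, X (s, x) -> support X x &
      forall s : seq L, (forall z, z \in s -> support X z) -> exists x, X (s, x)].
  by move=> CX Xp; have [X0'|//] := CP _ CX; rewrite X0' in Xp.
have Csup X : C X -> X `<=` \bigcup_(Y in C) Y by move=> CX p Xp; exists X.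
right; split.
- move=> s x y [X CX Xs] [Y CY Ys]; have [XY|YX] := Ctot _ _ CX CY.
    by have [+ _ _ _] := CPn _ _ CY Ys => /(_ s); apply=> //; exact: XY.
  by have [+ _ _ _] := CPn _ _ CX Xs => /(_ s); apply=> //; exact: YX.
- move=> s s' x [X CX Xs] [Y CY Ys]; have [XY|YX] := Ctot _ _ CX CY.
    by have [_ + _ _] := CPn _ _ CY Ys => /(_ s s' x); apply=> //; exact: XY.
  by have [_ + _ _] := CPn _ _ CX Xs => /(_ s s' x); apply=> //; exact: YX.
- move=> s x [X CX Xs]; apply: (supportS (Csup _ CX)).
  by have [_ _ + _] := CPn _ _ CX Xs; apply; exact: Xs.
- move=> s ssup.
  (* The entries of [s] involve finitely many members of the chain, so the largest of these supports
     all of [s]. *)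
  suff [X [CX [p Xp] sX]] : exists X, [/\ C X, X !=set0 &
      forall z, z \in s -> support X z].
    have [_ _ _ /(_ _ sX)[x Xs]] := CPn _ _ CX Xp.
    by exists x, X.
  elim: s ssup => [|z s IHs] ssup.
    by exists X0; split=> //; exists p0.
  have [|X [CX Xn0 sX]] := IHs.
    by move=> y ys; apply: ssup; rewrite inE ys orbT.
  have := ssup z; rewrite inE eqxx => /(_ isT) [jz|[t [y [[Y CY Yty] zt]]]].
    exists X; split=> // y; rewrite inE => /orP[/eqP ->|/sX//]; by left.
  have [XY|YX] := Ctot _ _ CX CY.
    exists Y; split=> //; first by exists (t, y).
    move=> x; rewrite inE => /orP[/eqP ->|/sX].
      by right; exists t, y.
    exact: supportS.
  exists X; split=> // x; rewrite inE => /orP[/eqP ->|/sX//].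
  by apply: (supportS YX); right; exists t, y.
Qed.

(** Sequences of natural numbers are countable; transported by [j], this provides a nonempty graph,
    so that a maximal graph cannot be empty. *)
Let seq_injection_range :
  seq_injection [set p | exists t, p = (map j t, j (pickle t))].
Proof.
set F0 := (X in seq_injection X).
have mem_range s : (forall z, z \in s -> range j z) -> exists t, s = map j t.
  elim: s => [|z s IHs] sj; first by exists [::].
  have [|t ->] := IHs; first by move=> y ys; apply: sj; rewrite inE ys orbT.
  by have := sj z; rewrite inE eqxx => /(_ isT)[n _ <-]; exists (n :: t).
right; split.
- by move=> s x y [t [-> ->]] [t' [/(inj_map j_inj) <- ->]].
- move=> s s' x [t [-> ->]] [t' [-> /j_inj]].
  by move=> /(pcan_inj (@pickleK _)) ->.
- by move=> s x [t [_ ->]]; left; exists (pickle t).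
- move=> s sF0; have [|t st] := mem_range s; last first.
    by exists (j (pickle t)), t; rewrite st.
  move=> z /sF0[//|[s' [y [[t [-> _]] /mapP[n _ ->]]]]].
  by exists n.
Qed.

(** Let [F] be a maximal graph, with support [A]. If the complement of [A] embeds in [A], then so
    does [L], and the injection given by [F] applies to sequences over [L]. Otherwise [A] has a copy
    [B] in its complement, and [F] extends to the sequences over the union of [A] and [B], against
    maximality. *)
Lemma seq_inj : exists phi : seq L -> L, injective phi.
Proof.
have [F [[F0|[Ffun Finj Fval Fdom]] Fmax]] := Zorn_bigcup seq_injection_bigcup.
  exfalso; apply: Fmax seq_injection_range; rewrite F0; split=> // sub0.
  by have := sub0 (map j [::], j (pickle ([::] : seq nat))); apply; exists [::].
set A := support F in Fdom Fval.
have /choice[phi phiF] s : exists x, (forall z, z \in s -> A z) -> F (s, x).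
  have [sA|nsA] := pselect (forall z, z \in s -> A z); last by exists (j 0%N).
  by have [x Fx] := Fdom _ sA; exists x.
have phiA s : (forall z, z \in s -> A z) -> A (phi s).
  by move=> /phiF/Fval.
have phi_inj s s' : (forall z, z \in s -> A z) -> (forall z, z \in s' -> A z) ->
    phi s = phi s' -> s = s'.
  move=> sA s'A e; apply: Finj (phiF _ sA) _; rewrite e; exact: phiF.
have A1 x : A x -> forall z, z \in [:: x] -> A z.
  by move=> Ax z; rewrite inE => /eqP ->.
have A2 x : A x -> forall z, z \in [:: x; x] -> A z.
  by move=> Ax z; rewrite !inE => /orP[] /eqP ->.
(* Words of length one and of length two have distinct codes, so [A] contains two disjoint copies of
   itself. *)
have doubling (B : set L) (d : L -> L) : (forall x, B x -> ~ A x -> A (d x)) ->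
    (forall x y, B x -> B y -> ~ A x -> ~ A y -> d x = d y -> x = y) ->
    exists c : L -> L, (forall x, A x \/ B x -> A (c x)) /\
      forall x y, A x \/ B x -> A y \/ B y -> c x = c y -> x = y.
  move=> dA dinj.
  exists (fun x => if `[< A x >] then phi [:: x] else phi [:: d x; d x]).
  split=> [x|x y].
    case: asboolP => [Ax _|nAx [//|Bx]]; apply: phiA; first exact: A1.
    by apply: A2; exact: dA.
  case: asboolP => [Ax _|nAx [//|Bx]].
    case: asboolP => [Ay _|nAy [//|By]].
      by move=> /phi_inj; move=> /(_ (A1 _ Ax) (A1 _ Ay)) [].
    by move=> /phi_inj; move=> /(_ (A1 _ Ax) (A2 _ (dA _ By nAy))).
  case: asboolP => [Ay _|nAy [//|By]].
    by move=> /phi_inj; move=> /(_ (A2 _ (dA _ Bx nAx)) (A1 _ Ay)).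
  move=> /phi_inj; move=> /(_ (A2 _ (dA _ Bx nAx)) (A2 _ (dA _ By nAy))) [].
  by move=> ? _; exact: dinj.
have map_in (B : set L) c s : (forall x, B x -> A (c x)) ->
    (forall z, z \in s -> B z) -> forall z, z \in map c s -> A z.
  by move=> cA sB z /mapP[y /sB By ->]; exact: cA.
pose Lp : pointedType := HB.pack L (isPointed.Build L (j 0%N)).
have [le_AC|le_CA] := card_le_total A (~` A); last first.
  have /(@pcard_leP _ Lp)/injfunPex[d dA dinj] := le_CA.
  have [|x y _ _ nAx nAy|c [cA cinj]] := doubling setT d.
  - by move=> x _ nAx; exact: dA.
  - by apply: dinj; rewrite inE.
  exists (fun s => phi (map c s)) => s s' /phi_inj e.
  apply: (@inj_map _ _ c) => [x y /cinj|]; first by apply; right.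
  by apply: e; apply: (map_in setT) => // x _; apply: cA; right.
have /(@pcard_leP _ Lp)/injfunPex[b bC binj] := le_AC.
pose B := b @` A.
have /choice[d db] x : exists a, B x -> A a /\ b a = x.
  have [[a Aa <-]|nBx] := pselect (B x); last by exists (j 0%N).
  by exists a.
have [x /db[]//|x y /db[_ bdx] /db[_ bdy] _ _ dxy|c [cA cinj]] := doubling B d.
  by rewrite -bdx -bdy dxy.
pose AB := [set x | A x \/ B x].
(* The new sequences take values in [B], disjoint from [A] where the old values lie; hence the union
   of the graphs is still injective. *)
pose N := [set p : seq L * L | [/\ forall z, z \in p.1 -> AB z,
  ~ (forall z, z \in p.1 -> A z) & p.2 = b (phi (map c p.1))]].
have map_cA s : (forall z, z \in s -> AB z) -> forall z, z \in map c s -> A z.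
  exact: map_in.
have FA s x : F (s, x) -> forall z, z \in s -> A z.
  by move=> Fsx z zs; right; exists s, x.
have NB s x : N (s, x) -> B x.
  by move=> [/= sAB _ ->]; exists (phi (map c s)) => //; apply: phiA; exact: map_cA.
have BnA x : B x -> ~ A x by move=> [a Aa <-]; exact: bC.
exfalso; apply: (Fmax (F `|` N)).
  split=> [p Fp|]; first by left.
  (* The one-letter word [b (j 0%N)] lies over [B] and not over [A], so [N] properly enlarges
     [F]. *)
  have Bb : B (b (j 0%N)) by exists (j 0%N) => //; left; exists 0%N.
  have nA : ~ A (b (j 0%N)) by exact: BnA.
  set s := [:: b (j 0%N)].
  move=> /(_ (s, b (phi (map c s)))) FN.
  apply: nA; apply: (@FA s _ (FN _)); last by rewrite inE.
  right; split=> //= [z|/(_ (b (j 0%N)))]; first by rewrite inE => /eqP ->; right.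
  by rewrite inE eqxx => /(_ isT) /(BnA _ Bb).
have supportE x : support (F `|` N) x -> AB x.
  move=> [jx|[s [y [[Fsy|[/= sAB _ _]] xs]]]]; [by left; left|left|exact: sAB].
  exact: FA Fsy _ xs.
right; split.
- move=> s x y [Fx|Nx] [Fy|Ny].
  + exact: Ffun Fx Fy.
  + by case: Ny => /= _ + _; case; exact: FA Fx.
  + by case: Nx => /= _ + _; case; exact: FA Fy.
  + by case: Nx Ny => /= _ _ -> [/= _ _ ->].
- move=> s s' x [Fx|Nx] [Fy|Ny].
  + exact: Finj Fx Fy.
  + by case: (BnA _ (NB _ _ Ny)); exact: Fval Fx.
  + by case: (BnA _ (NB _ _ Nx)); exact: Fval Fy.
  + case: Nx Ny => /= sAB _ -> [/= s'AB _ e].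
    have /phi_inj : phi (map c s) = phi (map c s').
      by apply: binj e; rewrite inE; apply: phiA; exact: map_cA.
    move=> /(_ (map_cA _ sAB) (map_cA _ s'AB)) {e}.
    elim: s s' sAB s'AB => [|z s IHs] [|z' s']//= sAB s'AB [e1 e2].
    congr cons.
      by apply: cinj e1; [apply: sAB|apply: s'AB]; rewrite inE eqxx.
    by apply: IHs => // y ys; [apply: sAB|apply: s'AB]; rewrite inE ys orbT.
- move=> s x [/Fval|/NB [a Aa <-]]; first by apply: supportS; left.
  right; exists [:: b a], (b (phi (map c [:: b a]))); split; last by rewrite inE.
  right; split=> //= [z|/(_ (b a))].
    by rewrite inE => /eqP ->; right; exists a.
  by rewrite inE eqxx => /(_ isT); exact: bC.
- move=> s ssup; have [sA|nsA] := pselect (forall z, z \in s -> A z).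
    by have [x Fx] := Fdom _ sA; exists x; left.
  exists (b (phi (map c s))); right; split=> //= z /ssup; exact: supportE.
Qed.

End SequencesOfInfiniteType.

(** * Comparison of densities *)

Lemma seq_card_le (L : Type) : ([set: nat] #<= [set: L])%card ->
  exists phi : seq L -> L, injective phi.
Proof.
move=> natL; have [j jinj] := card_le_ex_inj natL natL.
by apply: (@seq_inj {classic L} j) => x y; exact: jinj.
Qed.

(* K is the least infinite cardinal above D; this covers both branches of
   [has_density]. *)
Lemma exists_density (X : topologicalType) : exists (D : set X) (K : Type),
  [/\ dense D /\ (forall E : set X, dense E -> (D #<= E)%card),
      has_density X K, ([set: nat] #<= [set: K])%card, (D #<= [set: K])%card &
      forall L : Type, ([set: nat] #<= [set: L])%card ->
        (D #<= [set: L])%card -> ([set: K] #<= [set: L])%card].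
Proof.
have [|D dD Dmin] := @exists_least_card X [set E | dense E].
  by exists setT => O [x Ox] _; exists x.
have [finD|infD] := pselect (finite_set D).
  exists D, nat; split=> //; last exact: finite_set_countable.
  by exists D; split=> //; rewrite asboolT.
exists D, D; split=> //.
- by exists D; split=> //; rewrite asboolF// card_setT.
- by rewrite (card_le_eqr (card_setT D)); exact/infiniteP.
- by rewrite (card_le_eqr (card_setT D)); exact: card_lexx.
- by move=> L _; rewrite (card_le_eql (card_setT D)).
Qed.

(** The infinite cardinal [L] above a dense set of [Y] absorbs a countable factor and finite
    sequences, hence also bounds the dense image under [m]. *)
Lemma density_le_seq (C : countType) (X Y : topologicalType)
    (m : seq (C * Y) -> X) :
  (forall D, dense D -> dense (m @` [set s | forall p, p \in s -> D p.2])) ->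
  density_le X Y.
Proof.
move=> mdense.
have [DX [K [[_ DXmin] densX _ _ Kmin]]] := exists_density X.
have [DY [L [[dDY _] densY natL DYL _]]] := exists_density Y.
exists K, L; split=> //; apply: Kmin => //.
apply: card_le_trans (DXmin _ (mdense _ dDY)) _.
apply: card_le_trans (card_image_le _ _) _.
have [j jinj] := card_le_ex_inj natL natL.
have [i iinj] := card_le_ex_inj natL DYL.
have [phi phiinj] := seq_card_le natL.
(* [phi] is applied twice: to each pair, read as a two-letter word, and to the word of these
   codes. *)
apply: (@card_le_inj _ _ _ _ (fun s : seq (C * Y) =>
  phi [seq phi [:: j (pickle p.1); i p.2] | p <- s])) => // s s' /= sD s'D /phiinj.
elim: s s' sD s'D => [|[c d] s IHs] [|[c' d'] s']//= sD s'D [/phiinj[]].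
move=> /(jinj _ _ I I)/(pcan_inj (@pickleK _)) <- dd' ss'.
have -> : d = d'.
  apply: iinj dd'; [apply: (sD (c, d))|apply: (s'D (c', d'))]; exact: mem_head.
congr (_ :: _); apply: IHs ss' => p ps.
  by apply: sD; rewrite in_cons ps orbT.
by apply: s'D; rewrite in_cons ps orbT.
Qed.

(** * Closed spans in the bounded functions with the sup norm *)

Section UniformSpan.
Variables (R : realType) (G I : Type) (e : G -> I -> R).

Definition lincomb (s : seq (R * G)) : I -> R :=
  fun i => \sum_(p <- s) p.1 * e p.2 i.

(** Both V and W are spans of this kind. Boundedness is a separate clause since the generators [e b]
    are arbitrary here. *)
Definition uspan_pred : {pred I -> R} := fun x => `[<
  (exists M, forall i, `|x i| <= M) /\
  forall d, 0 < d -> exists s, forall i, `|x i - lincomb s i| <= d >].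

Lemma uspan_predP x : reflect ((exists M, forall i, `|x i| <= M) /\
  forall d, 0 < d -> exists s, forall i, `|x i - lincomb s i| <= d)
  (x \in uspan_pred).
Proof. exact: asboolP. Qed.

Lemma lincomb_cat s t i : lincomb (s ++ t) i = lincomb s i + lincomb t i.
Proof. by rewrite /lincomb big_cat. Qed.

Lemma lincombZ a s i :
  lincomb [seq (a * p.1, p.2) | p <- s] i = a * lincomb s i.
Proof. by rewrite /lincomb big_map mulr_sumr; apply: eq_bigr => p _; rewrite mulrA. Qed.

Lemma uspan_submod : submod_closed uspan_pred.
Proof.
split=> [|a x y /uspan_predP[[M xM] xs] /uspan_predP[[N yN] ys]];
    apply/uspan_predP; split.
- by exists 0 => i; rewrite normr0.
- by move=> d d0; exists [::] => i; rewrite /lincomb big_nil subrr normr0 ltW.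
- exists (`|a| * M + N) => i; rewrite (le_trans (ler_normD _ _))// lerD//.
  by rewrite normrM ler_wpM2l.
- move=> d d0; have a0 : 0 < `|a| + 1 by rewrite ltr_wpDl.
  have [|s xs'] := xs (d / 2 / (`|a| + 1)); first by rewrite !divr_gt0.
  have [|t yt] := ys (d / 2); first by rewrite !divr_gt0.
  exists ([seq (a * p.1, p.2) | p <- s] ++ t) => i.
  rewrite lincomb_cat lincombZ /= opprD addrACA -mulrBr [leRHS]splitr.
  rewrite (le_trans (ler_normD _ _))// lerD// normrM.
  rewrite (@le_trans _ _ ((`|a| + 1) * (d / 2 / (`|a| + 1))))//.
    by rewrite ler_pM// lerDl.
  by rewrite mulrC divfK ?gt_eqF.
Qed.

HB.instance Definition _ := GRing.isSubmodClosed.Build R (I -> R) uspan_pred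
  uspan_submod.

Record uspan := Uspan { uspan_val :> I -> R; _ : uspan_val \in uspan_pred }.

HB.instance Definition _ := [isSub for uspan_val].
HB.instance Definition _ := [Choice of uspan by <:].
HB.instance Definition _ := [SubChoice_isSubLmodule of uspan by <:].

Definition uspan_norm (x : uspan) : R := sup (range (fun i => `|x i|)).

Lemma uspan_bounded (x : uspan) : has_ubound (range (fun i => `|x i|)).
Proof.
by have /uspan_predP[[M xM] _] := valP x; exists M => _ [i _ <-]; exact: xM.
Qed.

Lemma uspan_approx (x : uspan) d : 0 < d ->
  exists s, forall i, `|x i - lincomb s i| <= d.
Proof. by have /uspan_predP[_] := valP x; exact. Qed.

Lemma uspan_coord_le (x : uspan) i : `|x i| <= uspan_norm x.
Proof. by apply: ub_le_sup; [exact: uspan_bounded|exists i]. Qed.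

Lemma uspan_norm_le (x : uspan) M : 0 <= M -> (forall i, `|x i| <= M) ->
  uspan_norm x <= M.
Proof.
(* For empty [I] the norm is [sup set0], which is 0; this is where [0 <= M] enters. *)
move=> M0 xM; have [[i _]|I0] := pselect (exists i : I, True).
  by apply: ge_sup; [exists `|x i|; exists i|move=> _ [k _ <-]].
rewrite /uspan_norm; have -> : range (fun i => `|x i|) = set0.
  by apply/seteqP; split=> // y [i]; case: I0; exists i.
by rewrite sup0.
Qed.

Lemma uspan_norm_ge0 x : 0 <= uspan_norm x.
Proof.
have [[i _]|I0] := pselect (exists i : I, True).
  exact: le_trans (uspan_coord_le x i).
rewrite /uspan_norm; have -> : range (fun i => `|x i|) = set0.
  by apply/seteqP; split=> // y [i]; case: I0; exists i.
by rewrite sup0.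
Qed.

Lemma uspan_normD x y : uspan_norm (x + y) <= uspan_norm x + uspan_norm y.
Proof.
apply: uspan_norm_le => [|i]; first by rewrite addr_ge0// uspan_norm_ge0.
by rewrite (le_trans (ler_normD _ _))// lerD// uspan_coord_le.
Qed.

Lemma uspan_normZ a x : uspan_norm (a *: x) = `|a| * uspan_norm x.
Proof.
apply/le_anti/andP; split.
  apply: uspan_norm_le => [|i]; first by rewrite mulr_ge0// uspan_norm_ge0.
  by rewrite normrM ler_wpM2l// uspan_coord_le.
have [->|a0] := eqVneq a 0; first by rewrite normr0 mul0r uspan_norm_ge0.
rewrite -ler_pdivlMl ?normr_gt0//.
apply: uspan_norm_le => [|i]; first by rewrite mulr_ge0// uspan_norm_ge0.
rewrite ler_pdivlMl ?normr_gt0// -normrM.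
exact: (uspan_coord_le (a *: x) i).
Qed.

Lemma uspan_norm0_eq0 x : uspan_norm x = 0 -> x = 0.
Proof.
move=> x0; apply/val_inj/funext => i; apply/eqP.
by rewrite -normr_le0 -x0; exact: (uspan_coord_le x).
Qed.

HB.instance Definition _ := Lmodule_isNormed.Build R uspan
  uspan_normD uspan_normZ uspan_norm0_eq0.

Lemma coord_le_norm (x : uspan) i : `|x i| <= `|x|.
Proof. exact: uspan_coord_le. Qed.

Lemma norm_le_coord (x : uspan) M : 0 <= M -> (forall i, `|x i| <= M) ->
  `|x| <= M.
Proof. exact: uspan_norm_le. Qed.

Lemma uspan_complete (F : set_system uspan) :
  ProperFilter F -> cauchy F -> cvg F.
Proof.
move=> FF /cauchy_ballP Fc; apply/cvg_ex.
have Fcoord i : cvg ((fun x : uspan => x i) @ F).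
  apply: cauchy_cvg; apply/cauchy_ballP => d d0.
  have [[A B] /= [FA FB] AB] := Fc _ d0.
  exists ([set x i | x in A], [set x i | x in B]) => /=.
    by split; [apply: filterS FA|apply: filterS FB] => x; exists x.
  move=> [_ _] [/= [x Ax <-] [y By <-]]; have := AB (x, y) (conj Ax By).
  rewrite -!ball_normE /ball_ /=.
  by apply: le_lt_trans; exact: (coord_le_norm (x - y) i).
pose l i := lim ((fun x : uspan => x i) @ F).
(* Letting [y] run along [F] in the Cauchy bound makes the pointwise convergence to [l] uniform in
   [i]. *)
have Fl d : 0 < d -> \forall x \near F, forall i, `|uspan_val x i - l i| <= d.
  move=> d0; have [[A B] /= [FA FB] AB] := Fc _ d0.
  apply: filterS FA => x Ax i; apply/ler_addgt0Pr => r r0.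
  have /cvgrPdist_lt/(_ _ r0) := Fcoord i.
  rewrite near_map => /(filterI FB)/filter_ex[y [By yl]].
  rewrite -[x i](subrK (y i)) -addrA (le_trans (ler_normD _ _))// lerD//.
    have := AB (x, y) (conj Ax By); rewrite -ball_normE => /ltW; apply: le_trans.
    exact: (coord_le_norm (x - y) i).
  by rewrite distrC ltW.
have lspan : l \in uspan_pred.
  apply/uspan_predP; split.
    have /filter_ex[x xl] := Fl _ ltr01.
    exists (1 + `|x|) => i.
    rewrite -[l i](subrK (x i)) (le_trans (ler_normD _ _))// lerD//.
      by rewrite distrC.
    exact: coord_le_norm.
  move=> d d0; have d20 : 0 < d / 2 by rewrite divr_gt0.
  have /filter_ex[x xl] := Fl _ d20.
  have [s xs] := uspan_approx x d20.
  exists s => i; rewrite -[l i](subrK (x i)) -addrA [leRHS]splitr.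
  by rewrite (le_trans (ler_normD _ _))// lerD// distrC.
exists (Uspan lspan); apply/cvgrPdist_le => d d0.
apply: filterS (Fl _ d0) => x xl; apply: norm_le_coord => [|i]; first exact: ltW.
by rewrite /= distrC; exact: xl.
Qed.

HB.instance Definition _ := Uniform_isComplete.Build uspan uspan_complete.

End UniformSpan.

(** * Generators of a span and its density *)

Section Generators.
Variables (R : realType) (G I : Type) (e : G -> I -> R).
Hypothesis e_bounded : forall b, exists M, forall i, `|e b i| <= M.

Lemma lincomb1 b i : lincomb e [:: (1, b)] i = e b i.
Proof. by rewrite /lincomb big_seq1 mul1r. Qed.

Lemma ugen_subproof b : e b \in uspan_pred e.
Proof.
apply/uspan_predP; split=> // d d0; exists [:: (1, b)] => i.
by rewrite lincomb1 subrr normr0 ltW.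
Qed.

Definition ugen b : uspan e := Uspan (ugen_subproof b).

Lemma sum_ugenE (s : seq (R * G)) :
  (\sum_(p <- s) p.1 *: ugen p.2 : uspan e) = lincomb e s :> (I -> R).
Proof.
apply/funext => i; elim: s => [|p s IHs]; rewrite /lincomb ?big_nil ?big_cons//.
by rewrite -[X in _ = _ + X]IHs.
Qed.

Lemma ugen_approx (x : uspan e) d : 0 < d ->
  exists s : seq (R * G), `|x - \sum_(p <- s) p.1 *: ugen p.2| <= d.
Proof.
move=> d0; have [s xs] := uspan_approx x d0; exists s.
apply: norm_le_coord => [|i]; first exact: ltW.
rewrite /= -[X in `|_ - X|]/((\sum_(p <- s) p.1 *: ugen p.2 : uspan e) i).
by rewrite sum_ugenE.
Qed.

End Generators.

Section TopologicalGenerators.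
Variables (R : realType) (G : topologicalType) (I : Type) (e : G -> I -> R).
Hypothesis e_bounded : forall b, exists M, forall i, `|e b i| <= M.
Hypothesis ugen_continuous : continuous (ugen e_bounded).

Lemma uspan_density_le : density_le (uspan e) G.
Proof.
apply: (@density_le_seq rat _ _
  (fun s => \sum_(p <- s) ratr p.1 *: ugen e_bounded p.2)) => D dD O [x Ox] oO.
have : nbhs x O by exact: open_nbhs_nbhs.
move=> /nbhs_ballP[d /= d0 xO].
have d20 : 0 < d / 2 by rewrite divr_gt0.
have [s xs] := ugen_approx e_bounded x d20.
suff [t tD st] : exists2 t : seq (rat * G), forall p, p \in t -> D p.2 &
    `|\sum_(p <- s) p.1 *: ugen e_bounded p.2 -
      \sum_(p <- t) ratr p.1 *: ugen e_bounded p.2| < d / 2.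
  exists (\sum_(p <- t) ratr p.1 *: ugen e_bounded p.2); split; last by exists t.
  apply: xO; rewrite -ball_normE /ball_ /=.
  rewrite -[x](subrK (\sum_(p <- s) p.1 *: ugen e_bounded p.2)) -addrA.
  by rewrite (le_lt_trans (ler_normD _ _))// [ltRHS]splitr ler_ltD.
(* Each summand uses up half of the remaining error [r]; joint continuity of scaling yields a
   rational coefficient and a point of [D] for it. *)
elim: s {xs} (d / 2) d20 => [|[c b] s IHs] r r0.
  by exists [::] => //; rewrite !big_nil subrr normr0.
have r20 : 0 < r / 2 by rewrite divr_gt0.
have [t tD st] := IHs _ r20.
have cvgu : (fun p : R * G => ugen e_bounded p.2) @ (c, b) --> ugen e_bounded b.
  apply: (@cvg_comp _ _ _ (@snd R G) (ugen e_bounded) _ (nbhs b)).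
    exact: cvg_snd.
  exact: ugen_continuous.
have cvg1 : (fun p : R * G => p.1) @ (c, b) --> c by exact: cvg_fst.
have FF : Filter (nbhs (c, b)) by exact: nbhs_filter.
have /cvgrPdist_lt/(_ _ r20)[[A B] /= [nA nB] AB] :=
  @cvgZ _ _ _ _ FF _ _ _ _ cvg1 cvgu.
have [q Aq] : exists q : rat, A (ratr q).
  have [||y [Ay [q _ qy]]] := @dense_rat R A^°; [|exact: open_interior|].
    by exists c; exact: nA.
  by exists q; rewrite qy; exact: interior_subset.
have [a [Ba Da]] : exists a, B a /\ D a.
  have [||a [Ba Da]] := dD B^°; [by exists b|exact: open_interior|].
  by exists a; split=> //; exact: interior_subset.
exists ((q, a) :: t) => [p|].
  by rewrite in_cons => /orP[/eqP ->|/tD].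
rewrite !big_cons opprD addrACA (le_lt_trans (ler_normD _ _))// [ltRHS]splitr.
by rewrite ltrD//; exact: (AB (ratr q, a)).
Qed.

End TopologicalGenerators.

(** * Isometries induced by permutations of the coordinates *)

Section PermutedCoordinates.
Variables (R : realType) (G : topGroupType) (I : Type) (e : G -> I -> R).
Hypothesis e_bounded : forall b, exists M, forall i, `|e b i| <= M.
Variables (act : G -> I -> I) (mv : G -> G -> G).
Hypothesis actK : forall g i, act g (act (g^-1)%g i) = i.
Hypothesis e_act : forall g b i, e b (act g i) = e (mv g b) i.

(** By [e_act], permuting the coordinates maps combinations of generators to combinations of
    generators. *)
Lemma uact_subproof g (x : uspan e) : (fun i => x (act g i)) \in uspan_pred e.
Proof.
apply/uspan_predP; split; first by exists `|x| => i; exact: coord_le_norm.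
move=> d d0; have [s xs] := uspan_approx x d0.
exists [seq (p.1, mv g p.2) | p <- s] => i; rewrite /lincomb big_map.
under eq_bigr do rewrite -e_act.
exact: xs.
Qed.

Definition uact g (x : uspan e) : uspan e := Uspan (uact_subproof g x).

Lemma uact_linear g : linear (uact g).
Proof. by move=> a x y; apply/val_inj. Qed.

HB.instance Definition _ g :=
  GRing.isLinear.Build R (uspan e) (uspan e) *:%R (uact g) (uact_linear g).

Lemma uact_onto g (y : uspan e) : exists x, uact g x = y.
Proof.
exists (uact (g^-1)%g y); apply/val_inj/funext => i /=.
by have := actK (g^-1)%g i; rewrite invgK => ->.
Qed.

Lemma norm_uact g (x : uspan e) : `|uact g x| = `|x|.
Proof.
apply/le_anti/andP; split; apply: norm_le_coord => // i.
  exact: (coord_le_norm x).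
by rewrite -(actK g i); exact: (coord_le_norm (uact g x)).
Qed.

Definition uiso g : iso (uspan e) := Iso (norm_uact g) (uact_onto g).

Lemma uiso_ugen g b : uiso g (ugen e_bounded b) = ugen e_bounded (mv g b).
Proof. by apply/val_inj/funext => i /=; rewrite e_act. Qed.

(** Isometries are equicontinuous, so strong continuity need only be checked on combinations of
    generators, whose orbits are continuous. *)
Lemma uiso_continuous : continuous (ugen e_bounded) ->
  (forall b, continuous (mv^~ b)) -> continuous uiso.
Proof.
move=> ce cmv g0; apply/iso_cvgP => v; apply/cvgrPdist_lt => d d0.
have d20 : 0 < d / 2 by rewrite divr_gt0.
have d40 : 0 < d / 2 / 2 by rewrite divr_gt0.
have [s vs] := ugen_approx e_bounded v d40.
set w := \sum_(p <- s) _ in vs.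
have uw : (fun g => uiso g w) =
    (fun g => \sum_(p <- s) p.1 *: ugen e_bounded (mv g p.2)).
  apply/funext => g; rewrite linear_sum; apply: eq_bigr => p _.
  by rewrite linearZ; congr (_ *: _); exact: uiso_ugen.
have cw : continuous (fun g => uiso g w).
  rewrite uw; apply: continuous_big => [|p _ g]; first exact: add_continuous.
  apply: cvgZl_tmp; exact: (cvg_comp _ _ (cmv p.2 g) (@ce _)).
have /cvgrPdist_lt/(_ _ d20) := cw g0.
rewrite !near_map; apply: filterS => g gw.
suff : `|uiso g0 v - uiso g v| < d by [].
have -> : uiso g0 v - uiso g v =
    uiso g0 (v - w) - uiso g (v - w) + (uiso g0 w - uiso g w).
  rewrite (linearB (uiso g0)) (linearB (uiso g)).
  by rewrite opprB addrAC !addrA !subrK.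
rewrite (le_lt_trans (ler_normD _ _))// [ltRHS]splitr ler_ltD//.
by rewrite (le_trans (ler_normB _ _))// [leRHS]splitr lerD// iso_isometry.
Qed.

End PermutedCoordinates.

(** * Translations of the group and two real inequalities *)

Section TopologicalGroupTranslations.
Variable G : topGroupType.

Lemma mulgl_continuous (a : G) : continuous (fun x : G => (a * x)%g).
Proof.
move=> x; apply: (@cvg_comp _ _ _ (fun x : G => (a, x))
  (fun p : G * G => (p.1 * p.2)%g) _ (nbhs (a, x))).
  by apply: cvg_pair; [exact: cvg_cst|exact: cvg_id].
exact: (@mulg_continuous G (a, x)).
Qed.

Lemma mulgr_continuous (a : G) : continuous (fun x : G => (x * a)%g).
Proof.
move=> x; apply: (@cvg_comp _ _ _ (fun x : G => (x, a))
  (fun p : G * G => (p.1 * p.2)%g) _ (nbhs (x, a))).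
  by apply: cvg_pair; [exact: cvg_id|exact: cvg_cst].
exact: (@mulg_continuous G (x, a)).
Qed.

Lemma near_mulVg (a : G) (U : set G) : nbhs (1%g : G) U ->
  \forall x \near a, U (a^-1 * x)%g.
Proof.
by move=> U1; apply: (@mulgl_continuous (a^-1)%g a U); rewrite mulVg.
Qed.

Lemma near_mulgV (a : G) (U : set G) : nbhs (1%g : G) U ->
  \forall x \near a, U (x * a^-1)%g.
Proof.
by move=> U1; apply: (@mulgr_continuous (a^-1)%g a U); rewrite mulgV.
Qed.

End TopologicalGroupTranslations.

Section RealInequalities.
Variable R : realType.
Implicit Types a p q x C : R.

(** This carries linear identities from combinations to their uniform limits: an approximation
    within [d] leaves an error of at most [d * C]. *)
Lemma eq0_norm_le x C :
  (forall d, 0 < d -> `|x| <= d * C) -> x = 0.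
Proof.
move=> xC; apply/eqP; rewrite -normr_le0; apply/ler_addgt0Pr => d d0.
have C0 : 0 <= C by have := le_trans (normr_ge0 _) (xC _ ltr01); rewrite mul1r.
have C1 : 0 < C + 1 by rewrite ltr_wpDl.
rewrite add0r (le_trans (xC (d / (C + 1)) _)) ?divr_gt0//.
by rewrite mulrAC ler_pdivrMr// ler_pM2l// lerDl.
Qed.

(** [|a|] is at most the geometric mean of its two bounds. If [q] is 0, the quotient is 0 by
    convention. *)
Lemma norm_div_sqrt_le a p q : `|a| <= p -> `|a| <= q ->
  `|a / Num.sqrt q| <= Num.sqrt p.
Proof.
move=> ap aq; have [q0|q0] := leP q 0.
  by rewrite ler0_sqrtr// invr0 mulr0 normr0 sqrtr_ge0.
rewrite normrM normfV (ger0_norm (sqrtr_ge0 _)) ler_pdivrMr ?sqrtr_gt0//.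
rewrite -sqrtrM; last exact: le_trans ap.
rewrite -(@sqrtr_sqr _ a) ler_wsqrtr// -real_normK ?num_real//.
by rewrite expr2 ler_pM.
Qed.

End RealInequalities.

(** * Pointwise form of uniform continuity *)

Section UniformlyContinuousTranslations.
Variables (R : realType) (G : topGroupType) (f : G -> R).

Lemma UC_bounded : UC f -> exists2 M, 0 <= M & forall g, `|f g| <= M.
Proof.
move=> [/ex_strict_bound_gt0[M M0 fM] _].
by exists M => [|g]; [exact: ltW|exact/ltW/fM].
Qed.

Lemma UC_near d : UC f -> 0 < d -> exists2 U, nbhs (1%g : G) U &
  forall u, U u -> forall g, `|f (u * g)%g - f g| <= d /\ `|f (g * u)%g - f g| <= d.
Proof.
move=> [_ fuc] d0; have [U U1 Uf] := fuc _ d0; exists U => // u /Uf[fl fr] g.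
split; rewrite -lee_fin; apply: le_trans (ltW _); [|exact: fl| |exact: fr].
  by apply: ereal_sup_ubound; exists g.
by apply: ereal_sup_ubound; exists g.
Qed.

Lemma UC_intro :
  (exists M, forall g, `|f g| <= M) ->
  (forall d, 0 < d -> exists2 U, nbhs (1%g : G) U &
    forall u, U u -> forall g,
      `|f (u * g)%g - f g| <= d /\ `|f (g * u)%g - f g| <= d) ->
  UC f.
Proof.
move=> [M fM] fuc; split.
  by exists M; split; [exact: num_real|move=> x /ltW Mx g _ /=; exact: le_trans Mx].
(* Pointwise bounds pass to the supremum only as weak inequalities; halving [d] makes them
   strict. *)
move=> d d0; have [|U U1 Uf] := fuc (d / 2); first by rewrite divr_gt0.
have d2d : ((d / 2)%:E < d%:E)%E by rewrite lte_fin ltr_pdivrMr// ltr_pMr// ltr1n.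
exists U => // u /Uf fu; split; apply: le_lt_trans d2d; apply: ge_ereal_sup.
  by move=> _ [g _ <-]; rewrite lee_fin; have [] := fu g.
by move=> _ [g _ <-]; rewrite lee_fin; have [] := fu g.
Qed.

End UniformlyContinuousTranslations.

(** * Matrix coefficients are uniformly continuous *)

Section RegularCoefficients.
Variables (R : realType) (G : topGroupType) (V W : normedModType R).

(** Left differences are controlled by the orbit of [v] and right differences by that of [psi]:
    after the translation by [g] is split off, isometry makes the bound independent of [g]. *)
Lemma regular_coef_UC (f : G -> R) : is_regular_coef V W f -> UC f.
Proof.
move=> [om [h1 [h2 [v [psi [omr [_ [_ h1M _ h2M omh]] [cv cpsi] ->]]]]]].
have h11 : h1 1%g = 1%g.
  by apply: (mulgI (h1 1%g)); rewrite -h1M !mulg1.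
have h21 : h2 1%g = 1%g.
  by apply: (mulgI (h2 1%g)); rewrite -h2M !mulg1.
apply: UC_intro.
  by exists (`|v| * `|psi|) => g; rewrite (le_trans (omr _ _))// iso_isometry.
move=> d d0.
have v0 : 0 < `|v| + 1 by rewrite ltr_wpDl.
have psi0 : 0 < `|psi| + 1 by rewrite ltr_wpDl.
have /cvgrPdist_lt/(_ (d / (`|psi| + 1)))/(_ _) Uv := cv 1%g.
have /cvgrPdist_lt/(_ (d / (`|v| + 1)))/(_ _) Upsi := cpsi 1%g.
exists ([set u | `|h1 1%g v - h1 u v| < d / (`|psi| + 1)] `&`
        [set u | `|h2 1%g psi - h2 u psi| < d / (`|v| + 1)]).
  by apply: filterI; [apply: Uv|apply: Upsi]; rewrite divr_gt0.
move=> u [/=]; rewrite h11 h21 distrC [in X in _ -> X -> _]distrC /= => uv upsi g.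
rewrite /matrix_coef; split.
  rewrite h1M /= -linearBl -linearB (le_trans (omr _ _))// iso_isometry.
  rewrite (le_trans (ler_wpM2r _ (ltW uv)))//.
  by rewrite mulrAC ler_pdivrMr// ler_pM2l// lerDl.
rewrite !omh h2M /= -linearBr -linearB -omh (le_trans (omr _ _))// iso_isometry.
rewrite (le_trans (ler_wpM2l _ (ltW upsi)))//.
rewrite mulrCA; apply: ler_piMr; first exact: ltW.
by rewrite ler_pdivrMr// mul1r lerDl.
Qed.

Lemma regular_bilinear_continuous (om : {bilinear V -> W -> R | *%R & *%R}) :
  regular_bilinear om -> continuous (fun p : V * W => om p.1 p.2).
Proof.
move=> omr [v psi]; apply/cvgrPdist_lt => d d0 /=.
have d20 : 0 < d / 2 by rewrite divr_gt0.
have psi0 : 0 < `|psi| + 1 by rewrite ltr_wpDl.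
have v0 : 0 < `|v| + 1 by rewrite ltr_wpDl.
(* The cap 1 gives [|v'| <= |v| + 1] for the second term below. *)
exists ([set v' | `|v - v'| < Num.min 1 (d / 2 / (`|psi| + 1))],
        [set psi' | `|psi - psi'| < d / 2 / (`|v| + 1)]) => /=.
  split; apply/nbhs_normP.
    by exists (Num.min 1 (d / 2 / (`|psi| + 1))) => //=; rewrite lt_min ltr01 divr_gt0.
  by exists (d / 2 / (`|v| + 1)) => //=; rewrite divr_gt0.
move=> [v' psi'] [/= vv' psipsi'].
have -> : om v psi - om v' psi' = om (v - v') psi + om v' (psi - psi').
  by rewrite linearBl linearBr addrA subrK.
rewrite (le_lt_trans (ler_normD _ _))// [ltRHS]splitr ltr_leD//.
  rewrite (le_lt_trans (omr _ _))//.
  move: vv'; rewrite lt_min => /andP[_]; rewrite ltr_pdivlMr//.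
  by apply: le_lt_trans; rewrite ler_wpM2l// lerDl.
rewrite (le_trans (omr _ _))//; move: psipsi'; rewrite ltr_pdivlMr// => /ltW.
apply: le_trans; rewrite mulrC ler_wpM2l//.
rewrite -[v'](subKr v) (le_trans (ler_normB _ _))// lerD2l.
by move: vv'; rewrite lt_min => /andP[/ltW].
Qed.

End RegularCoefficients.

Lemma subrACA (V : zmodType) (x y z t : V) : x - y - (z - t) = x - z - (y - t).
Proof. by rewrite !opprB addrACA [RHS]addrACA [- y - z]addrC. Qed.

(** * Construction of V, W and the pairing *)

Section Construction.
Variables (R : realType) (G : topGroupType) (f : G -> R).
Hypothesis fUC : UC f.

(** This is phi of the opening comment. *)
Definition rosc (u : G) : R := sup (range (fun g => `|f (g * u)%g - f g|)).

Lemma le_rosc u g : `|f (g * u)%g - f g| <= rosc u.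
Proof.
have [M _ fM] := UC_bounded fUC.
apply: ub_le_sup; last by exists g.
exists (M + M) => _ [h _ <-].
by rewrite (le_trans (ler_normB _ _))// lerD.
Qed.

Lemma rosc_le u C : (forall g, `|f (g * u)%g - f g| <= C) -> rosc u <= C.
Proof.
move=> fC; apply: ge_sup; first by exists `|f (1 * u)%g - f 1%g|; exists 1%g.
by move=> _ [g _ <-].
Qed.

Definition rho (u : G) : R := Num.sqrt (rosc u *+ 2).

Lemma rosc_ge0 u : 0 <= rosc u.
Proof. exact: le_trans (le_rosc u 1%g). Qed.

Lemma near_rho d : 0 < d -> exists2 U, nbhs (1%g : G) U &
  forall u, U u -> rho u <= d.
Proof.
(* The bound is chosen so that doubling it and taking the root returns [d]. *)
move=> d0; have [|U U1 Uf] := UC_near (d := d ^+ 2 / 2) fUC.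
  by rewrite divr_gt0// exprn_gt0.
exists U => // u /Uf fu; rewrite -(ger0_norm (ltW d0)) -sqrtr_sqr ler_wsqrtr//.
rewrite -mulr_natr -ler_pdivlMr//; apply: rosc_le => g.
by have [] := fu g.
Qed.

(* The translate x |-> f (b x) is encoded by its values and its divided
   differences, so that the norm of V becomes a sup norm. When rho u = 0 the
   difference vanishes and so does the quotient (x / 0 = 0). *)
Definition tvec (b : G) (i : G + G * G) : R :=
  match i with
  | inl x => f (b * x)%g
  | inr (g, u) => (f (b * g * u)%g - f (b * g)%g) / rho u
  end.

(** A difference with increment [u] is bounded by the square of [rho u] and by a constant, so its
    quotient by [rho u] is at most the root of the constant. *)
Lemma tvec_bounded b : exists M, forall i, `|tvec b i| <= M.
Proof.
have [M M0 fM] := UC_bounded fUC.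
exists (M + Num.sqrt ((M + M) *+ 2)) => -[x|[g u]] /=.
  by rewrite (le_trans (fM _))// lerDl sqrtr_ge0.
have fMM h : `|f (h * u)%g - f h| <= M + M.
  by rewrite (le_trans (ler_normB _ _))// lerD.
have le2 (x : R) : 0 <= x -> x <= x *+ 2 by move=> x0; rewrite mulr2n lerDl.
rewrite (@le_trans _ _ (Num.sqrt ((M + M) *+ 2)))// ?lerDr//.
apply: norm_div_sqrt_le.
  by rewrite (le_trans (fMM _))// le2// addr_ge0.
by rewrite (le_trans (le_rosc _ _))// le2// rosc_ge0.
Qed.

Notation V := (uspan tvec).

(** Left translation moves the base point and keeps the right increment [u], so it permutes the
    divided differences with their denominators. *)
Definition tact (a : G) (i : G + G * G) : G + G * G :=
  match i with inl x => inl (a * x)%g | inr (g, u) => inr ((a * g)%g, u) end.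

Lemma tactK g i : tact g (tact (g^-1)%g i) = i.
Proof. by case: i => [x|[x u]] /=; rewrite mulVKg. Qed.

Lemma tactM x y i : tact (x * y)%g i = tact x (tact y i).
Proof. by case: i => [z|[z u]] /=; rewrite mulgA. Qed.

Lemma tvec_act g b i : tvec b (tact g i) = tvec (b * g)%g i.
Proof. by case: i => [x|[x u]] /=; rewrite !mulgA. Qed.

Definition right_iso (g : G) : iso V :=
  uiso (act := tact) (mv := fun g b => (b * g)%g) tactK tvec_act g.

Lemma right_isoM x y : right_iso (x * y)%g = (right_iso y * right_iso x)%g.
Proof.
apply: isoP => v; apply/val_inj/funext => i.
by rewrite /= tactM.
Qed.

Lemma tgen_continuous : continuous (ugen tvec_bounded).
Proof.
move=> b; apply/cvgrPdist_le => d d0.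
(* [d] serves the values; two bounds [d ^+ 2 / 2] add up to [d ^+ 2] for the second differences. *)
have [|U U1 Uf] := UC_near (d := Num.min d (d ^+ 2 / 2)) fUC.
  by rewrite lt_min d0 divr_gt0// exprn_gt0.
apply: filterS (near_mulgV b U1) => b' /Uf fU.
have {fU} fb x : `|f (b * x)%g - f (b' * x)%g| <= Num.min d (d ^+ 2 / 2).
  by have [+ _] := fU (b * x)%g; rewrite !mulgA mulgVK distrC.
have fd x : `|f (b * x)%g - f (b' * x)%g| <= d.
  by have := fb x; rewrite le_min => /andP[].
have fd2 x : `|f (b * x)%g - f (b' * x)%g| <= d ^+ 2 / 2.
  by have := fb x; rewrite le_min => /andP[].
apply: norm_le_coord => [|[x|[g u]] /=]; [exact: ltW|exact: fd|].
change (`|tvec b (inr (g, u)) - tvec b' (inr (g, u))| <= d).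
rewrite /= -mulrBl -(ger0_norm (ltW d0)) -(sqrtr_sqr d).
(* Pairing [b] with [b'] at equal points gives the bound [d ^+ 2]; the original grouping gives twice
   [rosc u]. *)
apply: norm_div_sqrt_le.
  by rewrite subrACA -!mulgA [leRHS]splitr (le_trans (ler_normB _ _))// lerD.
rewrite mulr2n (le_trans (ler_normB _ _))// lerD//; exact: le_rosc.
Qed.

(** The relation holds for the generators, is linear and survives uniform limits. It lets the norm
    of V control right differences of the values. *)
Lemma rhoP (v : V) g u : v (inl (g * u)%g) - v (inl g) = rho u * v (inr (g, u)).
Proof.
have tvecP b : tvec b (inl (g * u)%g) - tvec b (inl g) =
    rho u * tvec b (inr (g, u)).
  rewrite /= mulrC; have [rho0|rho0] := eqVneq (rho u) 0; last first.
    by rewrite divfK// mulgA.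
  rewrite rho0 mulr0 mulgA; apply/eqP; rewrite -normr_le0.
  rewrite (le_trans (le_rosc _ _))//.
  move/eqP : rho0; rewrite sqrtr_eq0 => /(le_trans _) -> //.
  by rewrite mulr2n lerDl rosc_ge0.
apply/eqP; rewrite -subr_eq0; apply/eqP.
(* Three coordinates of [v] get approximated, the last one with weight [rho u]. *)
apply: (@eq0_norm_le _ _ (1 + 1 + `|rho u|)) => d d0.
have [s vs] := uspan_approx v d0.
have sP : lincomb tvec s (inl (g * u)%g) - lincomb tvec s (inl g) =
    rho u * lincomb tvec s (inr (g, u)).
  rewrite /lincomb -sumrB mulr_sumr; apply: eq_bigr => p _.
  by rewrite -mulrBr tvecP mulrCA.
have -> : v (inl (g * u)%g) - v (inl g) - rho u * v (inr (g, u)) =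
    (v (inl (g * u)%g) - lincomb tvec s (inl (g * u)%g)) -
    (v (inl g) - lincomb tvec s (inl g)) -
    rho u * (v (inr (g, u)) - lincomb tvec s (inr (g, u))).
  by rewrite mulrBr -sP [X in _ = X - _]subrACA [RHS]subrACA subrr subr0.
rewrite [leRHS]mulrDr [X in _ <= X + _]mulrDr mulr1.
rewrite (le_trans (ler_normB _ _))// lerD//.
  by rewrite (le_trans (ler_normB _ _))// lerD.
by rewrite normrM mulrC ler_wpM2r.
Qed.

Lemma coord_dist_le (v : V) g u :
  `|v (inl (g * u)%g) - v (inl g)| <= rho u * `|v|.
Proof.
rewrite rhoP normrM (ger0_norm (sqrtr_ge0 _)) ler_wpM2l ?sqrtr_ge0//.
exact: coord_le_norm.
Qed.

(* Functionals psi on V are encoded as v |-> psi v / |v|, so that the dual norm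
   becomes a sup norm. *)
Definition evec (x : G) (v : V) : R := v (inl x) / `|v|.

Lemma evec_bounded x : exists M, forall v, `|evec x v| <= M.
Proof.
exists 1 => v; rewrite normrM normfV normr_id.
have [->|v0] := eqVneq `|v| 0; first by rewrite invr0 mulr0.
by rewrite ler_pdivrMr ?lt0r ?v0 ?normr_ge0// mul1r coord_le_norm.
Qed.

Notation W := (uspan evec).

Lemma right_isoK g (v : V) : right_iso g (right_iso (g^-1)%g v) = v.
Proof.
apply/val_inj/funext => i /=.
by have := tactK (g^-1)%g i; rewrite invgK => ->.
Qed.

Lemma evec_act g b v : evec b (right_iso g v) = evec (g * b)%g v.
Proof. by rewrite /evec iso_isometry. Qed.

(** The adjoint of [right_iso g], which as an isometry leaves the denominators in [evec]
    unchanged. *)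
Definition left_iso (g : G) : iso W :=
  uiso (act := fun g => right_iso g : V -> V) (mv := fun g b => (g * b)%g)
    right_isoK evec_act g.

Lemma left_isoM x y : left_iso (x * y)%g = (left_iso x * left_iso y)%g.
Proof.
apply: isoP => psi; apply/val_inj/funext => v.
change (psi (right_iso (x * y)%g v) = psi (right_iso y (right_iso x v))).
by rewrite right_isoM.
Qed.

Lemma egen_continuous : continuous (ugen evec_bounded).
Proof.
move=> b; apply/cvgrPdist_le => d d0.
have [U U1 Uf] := near_rho d0.
apply: filterS (near_mulVg b U1) => b' /Uf rd.
apply: norm_le_coord => [|v] /=; first exact: ltW.
change (`|evec b v - evec b' v| <= d).
rewrite /evec -mulrBl normrM normfV normr_id distrC.
have [->|v0] := eqVneq `|v| 0; first by rewrite invr0 mulr0 ltW.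
rewrite ler_pdivrMr ?lt0r ?v0 ?normr_ge0//.
have := coord_dist_le v b (b^-1 * b')%g; rewrite mulVKg => /le_trans; apply.
by rewrite ler_wpM2r.
Qed.

(** The factor [|v|] undoes the division in [evec]: this is the value of the functional [psi] at
    [v]. *)
Definition pairing (v : V) (psi : W) : R := `|v| * psi v.

Lemma pairing_approx (psi : W) d : 0 < d -> exists s : seq (R * G),
  forall v, `|pairing v psi - \sum_(p <- s) p.1 * v (inl p.2)| <= d * `|v|.
Proof.
move=> d0; have [s ps] := uspan_approx psi d0; exists s => v.
have [->|v0] := eqVneq v 0.
  rewrite /pairing normr0 mulr0 mul0r big1 ?subrr ?normr0// => p _.
  by rewrite mulr0.
have -> : \sum_(p <- s) p.1 * v (inl p.2) = `|v| * lincomb evec s v.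
  rewrite /lincomb mulr_sumr; apply: eq_bigr => p _; rewrite mulrCA /evec.
  by rewrite [X in _ = _ * X]mulrC divfK// normr_eq0.
by rewrite /pairing -mulrBr normrM normr_id mulrC ler_wpM2r.
Qed.

(** Elements of W are encoded as mere functions on V; linearity is inherited from combinations of
    point evaluations as the error [d] tends to 0. *)
Lemma pairing_linearl (psi : W) a (v v' : V) :
  pairing (a *: v + v') psi = a * pairing v psi + pairing v' psi.
Proof.
apply/eqP; rewrite -subr_eq0; apply/eqP.
apply: (@eq0_norm_le _ _ (`|a *: v + v'| + (`|a| * `|v| + `|v'|))) => d d0.
have [s ps] := pairing_approx psi d0.
pose l (w : V) := \sum_(p <- s) p.1 * w (inl p.2).
have lP : l (a *: v + v') = a * l v + l v'.
  rewrite /l mulr_sumr -big_split; apply: eq_bigr => p _ /=.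
  by rewrite mulrDr mulrCA.
have -> : pairing (a *: v + v') psi - (a * pairing v psi + pairing v' psi) =
   (pairing (a *: v + v') psi - l (a *: v + v')) -
   (a * (pairing v psi - l v) + (pairing v' psi - l v')).
  by rewrite lP mulrBr addrACA -opprD [RHS]subrACA subrr subr0.
rewrite [leRHS]mulrDr [X in _ <= _ + X]mulrDr.
rewrite (le_trans (ler_normB _ _))// lerD//.
rewrite (le_trans (ler_normD _ _))// lerD//.
by rewrite normrM mulrCA ler_wpM2l.
Qed.

Lemma pairing_bilinear : bilinear_for
  (GRing.Scale.Law.clone _ _ *%R _) (GRing.Scale.Law.clone _ _ *%R _) pairing.
Proof.
split=> [psi|v] a x y /=; first exact: pairing_linearl.
by rewrite /pairing /= mulrDr mulrCA.
Qed.

HB.instance Definition _ := bilinear_isBilinear.Build R V W R _ _ pairing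
  pairing_bilinear.

Lemma UC_regular_coef : exists V W : completeNormedModType R,
  [/\ is_regular_coef V W f, density_le V G & density_le W G].
Proof.
exists V, W; split.
- exists pairing, right_iso, left_iso.
  (* The vector is [f] itself and the functional is evaluation at the identity, so the coefficient
     at [g] is the translate of [f] by [g] taken at 1. *)
  exists (ugen tvec_bounded 1%g), (ugen evec_bounded 1%g).
  have preg : regular_bilinear pairing.
    by move=> v psi; rewrite normrM normr_id ler_wpM2l// coord_le_norm.
  have cright : continuous right_iso.
    by move=> g; exact: (uiso_continuous tgen_continuous (@mulgl_continuous G)).
  have cleft : continuous left_iso.
    by move=> g; exact: (uiso_continuous egen_continuous (@mulgr_continuous G)).
  split=> //.
  + split; first exact: regular_bilinear_continuous.
    split=> //; [exact: right_isoM|exact: left_isoM|] => g v psi.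
    by rewrite -[LHS]/(`|right_iso g v| * psi (right_iso g v)) iso_isometry.
  + split=> g.
      exact: (cvg_comp _ _ (cright g) (@iso_cvg _ _ (right_iso g) _)).
    exact: (cvg_comp _ _ (cleft g) (@iso_cvg _ _ (left_iso g) _)).
  + apply/funext => g; rewrite /matrix_coef /= /pairing /=.
    set w := right_iso g _.
    have fw : w (inl 1%g) = f g by rewrite /= mul1g mulg1.
    rewrite /evec fw; have [w0|w0] := eqVneq w 0.
      by rewrite w0 normr0 mul0r -fw w0.
    by rewrite mulrC divfK// normr_eq0.
- exact: uspan_density_le tgen_continuous.
- exact: uspan_density_le egen_continuous.
Qed.

End Construction.

Theorem theorem5p10 (R : realType) (G : topGroupType)
    (hG : hausdorff_space G) (f : G -> R) :
  (UC f <-> exists V W : completeNormedModType R, is_regular_coef V W f) /\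
  ((exists V W : completeNormedModType R, is_regular_coef V W f) ->
   exists V W : completeNormedModType R,
     [/\ is_regular_coef V W f, density_le V G & density_le W G]).
Proof.
(* For the density clause, the given spaces only show that [f] is in UC(G); small ones are then
   built from [f]. *)
split=> [|[V [W /regular_coef_UC/UC_regular_coef//]]].
split=> [/UC_regular_coef[V [W [fVW _ _]]]|[V [W /regular_coef_UC//]]].
by exists V, W.
Qed.
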